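(* Let $p$ be a power of two and let $X_1,X_2,\dots$ be the sequence of vectors produced by the periodic scheme with $x=2$ (described in the context). Then for every $X_i$, $$\frac{\max X_i}{\operatorname{avg}X_i}\le\frac{\ln 2}{\sqrt2-1}+O(1/p)\approx 1.673+O(1/p),$$ where $\max$ and $\operatorname{avg}$ denote the maximum and average of the $p$ entries.
   Context: Periodic scheme (parameter $p$, real $x>0$): for a base $b\in\{1,\dots,p\}$, the super-partition $S^{(b)}$ is a sequence of positive reals whose initial configuration is $(x^{b/p},x^{(b+1)/p},\dots,x^{(b+p-1)/p})$ (first entry $x^{b/p}$, each next entry $x^{1/p}$ times the previous one); one step of evolution (''merge-next'') replaces the pair of adjacent entries with minimal sum by their sum, decreasing the length by one. The scheme: set $j\gets1$ and $X_1\gets$ the initial configuration of $S^{(1)}$; then, $p-1$ times, for $i=1,\dots,p$: apply merge-next to $S^{(i)}$, let $X'$ be the vector of the first $p$ entries of the concatenation $S^{(1)}S^{(2)}\cdots S^{(p)}$, and if $X'\neq X_j$ set $j\gets j+1$, $X_j\gets X'$. *)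

(* Defs.v *)
From HB Require Import structures.
From mathcomp Require Import all_boot all_order all_algebra.
From mathcomp Require Import all_classical all_reals all_analysis.
Set Implicit Arguments.
Unset Strict Implicit.
Unset Printing Implicit Defensive.
Import Order.TTheory GRing.Theory Num.Theory.
Local Open Scope ring_scope.

Definition adjacent_sums (R : realType) (s : seq R) : seq R :=
  if s is a :: t then pairmap +%R a t else [::].

(* Position k of the adjacent pair (s_k, s_(k+1)) of minimal sum; if several
   pairs have the minimal sum, the leftmost one. *)
Definition min_pair (R : realType) (s : seq R) : nat :=
  find (fun m => all (fun m' => m <= m') (adjacent_sums s)) (adjacent_sums s).

(* Only meaningful when s has at least two entries. *)
Definition merge_next (R : realType) (s : seq R) : seq R :=
  let k := min_pair s in
  take k s ++ (s`_k + s`_k.+1) :: drop k.+2 s.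

Definition super_partition_init (R : realType) (p : nat) (x : R) (b : nat) :
    seq R :=
  mkseq (fun k => x `^ ((b + k)%:R / p%:R)) p.

(* A state of the scheme is a pair (Ss, Xs): Ss lists the current
   super-partitions S^(1), ..., S^(p) (S^(i) is the entry of index i - 1) and
   Xs lists the vectors X_1, ..., X_j produced so far. *)
Definition scheme_state (R : realType) : Type :=
  (seq (seq R) * seq (seq R))%type.

Definition scheme_init (R : realType) (p : nat) (x : R) : scheme_state R :=
  ([seq super_partition_init p x b | b <- iota 1 p],
   [:: super_partition_init p x 1]).

Definition scheme_step (R : realType) (p : nat) (st : scheme_state R)
    (i : nat) : scheme_state R :=
  let: (Ss, Xs) := st in
  let Ss' := set_nth [::] Ss i.-1 (merge_next (nth [::] Ss i.-1)) in
  let X' := take p (flatten Ss') in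
  (Ss', if X' != last [::] Xs then rcons Xs X' else Xs).

Definition scheme_round (R : realType) (p : nat) (st : scheme_state R) :
    scheme_state R :=
  foldl (scheme_step p) st (iota 1 p).

Definition periodic_scheme (R : realType) (p : nat) (x : R) : seq (seq R) :=
  (iter p.-1 (scheme_round p) (scheme_init p x)).2.

(* The default value 0 is harmless: all the vectors considered are nonempty
   with positive entries. *)
Definition max_entry (R : realType) (X : seq R) : R :=
  \big[Num.max/0]_(a <- X) a.

Definition avg_entry (R : realType) (X : seq R) : R :=
  (\sum_(a <- X) a) / (size X)%:R.

(* Main.v *)
Require Import Defs.
From HB Require Import structures.
From mathcomp Require Import all_boot all_order all_algebra.
From mathcomp Require Import all_classical all_reals all_analysis.
From mathcomp Require Import ring lra zify.
Import Order.TTheory GRing.Theory Num.Theory.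
Local Open Scope ring_scope.

(* Put q = 2^(1/p), so that S^(b) starts as q^b, ..., q^(b+p-1) and its total
   q^b/(q-1) is preserved by merging.  When m = p/L entries are left, where L is
   a power of two, they are the increments of q^b/(q-1) r^k with r = q^L and
   r^m = 2, and merge-next then merges the pairs (0,1), (2,3), ... from left to
   right: as the entries span a factor less than 2, no merged entry is touched
   before all of them have been merged.  A vector of the scheme consists of some
   whole blocks and a prefix of the next one, which gives its sum and a bound on
   its largest entry.  If the blocks have undergone t merges at this level, and
   the first i of them one more, the theorem comes down to

     (sqrt 2 - 1) q^i (r^2 - 1) r^(2t) <= 2^((1 + i/p)/(m - t)) - 1,

   tight only for m = 2, i = 0.  For m >= 4 it follows with room to spare from
   (m - t) r^(2t) <= 2m/(e ln 2), and this room pays for the truncated block. *)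

(** * Numerical bounds on exp, ln 2, e and sqrt 2 *)

Lemma expR_ge_taylor (R : realType) (x : R) (n : nat) : 0 <= x ->
  \sum_(k < n) x ^+ k / k`!%:R <= expR x.
Proof.
move=> x0; rewrite -(big_mkord xpredT (fun k => x ^+ k / k`!%:R)).
apply: (@nondecreasing_cvgn_le R (series (exp_coeff x))).
  by apply/nondecreasing_seqP => k; rewrite -subr_ge0 seriesSB exp_coeff_ge0.
exact: is_cvg_series_exp_coeff.
Qed.

(** As [(n + d)! >= n!], the tail is dominated by a geometric series of ratio [x]. *)
Lemma expR_le_taylor (R : realType) (x : R) (n : nat) : 0 <= x -> x < 1 ->
  expR x <= \sum_(k < n) x ^+ k / k`!%:R + x ^+ n / n`!%:R / (1 - x).
Proof.
move=> x0 x1; have Hx : 0 < 1 - x by lra.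
apply: limr_le; first exact: is_cvg_series_exp_coeff.
near=> N; rewrite /series /=.
have nN : (n <= N)%N by near: N; exact: nbhs_infty_ge.
rewrite -(subnKC nN); move: (N - n)%N => e.
rewrite (big_cat_nat (leq0n n) (leq_addr e n)) //= big_mkord lerD2l.
rewrite -{1}[n]add0n big_addn addKn.
suff H : forall d, \sum_(0 <= i < d) exp_coeff x (i + n)%N <=
    x ^+ n / n`!%:R * ((1 - x ^+ d) / (1 - x)).
  apply: le_trans (H _) _; apply: ler_wpM2l; first exact: exp_coeff_ge0.
  rewrite -[leRHS]mul1r ler_pM2r ?invr_gt0 // gerBl exprn_ge0 //.
elim=> [|d IH]; first by rewrite big_geq // expr0 subrr mul0r mulr0.
rewrite big_nat_recr //=; apply: le_trans (lerD IH (lexx _)) _.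
have -> : (1 - x ^+ d.+1) / (1 - x) = (1 - x ^+ d) / (1 - x) + x ^+ d.
  by rewrite exprS; field; lra.
rewrite mulrDr lerD2l /exp_coeff /= exprD -mulrA [leLHS]mulrC -[leRHS]mulrA.
rewrite -[leLHS]mulrA; apply: ler_wpM2l; first exact: exprn_ge0.
apply: ler_wpM2r; first exact: exprn_ge0.
rewrite lef_pV2 ?posrE ?ltr0n ?fact_gt0 // ler_nat.
elim: d {IH} => // d /leq_trans; apply.
by rewrite addSn factS leq_pmull.
Unshelve. all: by end_near. Qed.

Lemma ln2_bounds (R : realType) :
  693 / 1000 <= ln (2 : R) /\ ln (2 : R) <= 253 / 365.
Proof.
split; rewrite -ler_expR lnK ?posrE //.
  apply: (le_trans (@expR_le_taylor _ _ 7 _ _)); [lra|lra|].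
  have -> : (1 - 693 / 1000 : R) = 307 / 1000 by field.
  rewrite !big_ord_recr big_ord0 /= !factS fact0.
  rewrite invf_div.
  lra.
apply: (le_trans _ (@expR_ge_taylor _ _ 9 _)); last by lra.
rewrite !big_ord_recr big_ord0 /= !factS fact0.
lra.
Qed.
Lemma expR1_ge (R : realType) : 1359 / 500 <= expR (1 : R).
Proof.
apply: (le_trans _ (@expR_ge_taylor _ _ 8 _)); last by lra.
by rewrite !big_ord_recr big_ord0 /= !factS fact0; lra.
Qed.

Lemma sqrt2_bounds (R : realType) :
  239 / 169 <= Num.sqrt (2 : R) /\ Num.sqrt (2 : R) <= 99 / 70.
Proof.
have := sqr_sqrtr (ler0n R 2); have := sqrtr_ge0 (2 : R).
by move: (Num.sqrt 2) => s s0 s2; split; nra.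
Qed.

(** The ratio is 1.67340..., which leaves an upper margin of only about 0.0001; hence the sharp
    bounds on [ln 2] and the convergents [239/169] and [99/70] of [sqrt 2]. *)
Lemma limit_ratio_approx (R : realType) :
  `| ln (2 : R) / (Num.sqrt (2 : R) - 1) - 1673%:R / 1000%:R |
       <= (2000%:R : R)^-1.
Proof.
have [l1 l2] := ln2_bounds R; have [s1 s2] := sqrt2_bounds R.
have s0 : 0 < Num.sqrt (2 : R) - 1 by lra.
rewrite ler_norml lerBrDr lerBlDr ler_pdivlMr // ler_pdivrMr //.
by apply/andP; split; lra.
Qed.

(** * Convexity estimates for powers of 2 *)

(** [W] is the mean of [a] and [1] with weights [s] and [1 - s]. Adding [ln x <= x - 1] at [a/W] and
    [1/W] with these weights gives [s ln a <= ln W]. *)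
Lemma powR_le_chord (R : realType) (a s : R) : 0 < a -> 0 <= s -> s <= 1 ->
  a `^ s <= 1 + s * (a - 1).
Proof.
move=> a0 s0 s1; set W := 1 + _.
have W0 : 0 < W by rewrite /W; have [->|] := eqVneq s 1; [lra|nra].
have ln_le (x : R) : 0 < x -> ln x <= x - 1.
  by move=> x0; rewrite -{1}(addrNK 1 x) addrC le_ln1Dx; lra.
rewrite -ler_ln ?posrE ?powR_gt0 // ln_powR.
have h1 := ln_le _ (divr_gt0 a0 W0); have h2 := ln_le _ (divr_gt0 (@ltr01 R) W0).
rewrite ln_div ?posrE // in h1; rewrite ln_div ?posrE // ln1 in h2.
have e : s * (a / W - 1) + (1 - s) * (1 / W - 1) = 0.
  have -> : s * (a / W - 1) + (1 - s) * (1 / W - 1) = (1 + s * (a - 1) - W) / W.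
    by field; exact: lt0r_neq0.
  by rewrite subrr mul0r.
have := ler_wpM2l s0 h1; have s1' : 0 <= 1 - s by lra.
by have := ler_wpM2l s1' h2; nra.
Qed.

Lemma exp2D (R : realType) (x y : R) : 2 `^ (x + y) = 2 `^ x * 2 `^ y.
Proof. by rewrite powRD // pnatr_eq0 implybT. Qed.

Lemma exp2X (R : realType) (x : R) (n : nat) : (2 `^ x) ^+ n = 2 `^ (x * n%:R).
Proof. by rewrite -powR_mulrn ?powR_ge0 // -powRrM. Qed.

Lemma exp2_ge1 (R : realType) (x : R) : 0 <= x -> 1 <= 2 `^ x.
Proof. by move=> x0; rewrite -[leLHS](powRr0 (2 : R)) ler_powR // ler1n. Qed.

Lemma exp2_gt1 (R : realType) (x : R) : 0 < x -> 1 < 2 `^ x.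
Proof.
move=> x0; rewrite -[ltLHS](powRr0 (2 : R)) /powR pnatr_eq0 /= ltr_expR mul0r.
by rewrite mulr_gt0 // ln_gt0 // ltr1n.
Qed.

(** The tangent at [u = 1/2], of slope [sqrt 2 ln 2] just below 1, stays above [u + 9/10]. The
    missing 1/10 becomes the loss on the truncated block. *)
Lemma exp2_ge_affine (R : realType) (u : R) : 0 <= u -> u <= 1 ->
  u + 9 / 10 <= 2 `^ u.
Proof.
move=> u0 u1; have [l1 l2] := ln2_bounds R; have [s1 s2] := sqrt2_bounds R.
have -> : u = 2^-1 + (u - 2^-1) by ring.
rewrite exp2D powR12_sqrt //.
have h : 1 + (u - 2^-1) * ln 2 <= 2 `^ (u - 2^-1).
  by rewrite /powR pnatr_eq0 /= expR_ge1Dx.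
have s0 : 0 <= Num.sqrt (2 : R) by lra.
have := ler_wpM2l s0 h; move: s1 s2; set s := Num.sqrt 2 => s1 s2.
apply: le_trans.
have l3 : 134 / 140 <= s * ln 2 by nra.
have l4 : s * ln 2 <= 1 by nra.
by rewrite mulrDr mulr1 mulrCA; nra.
Qed.

(** With [y = 2 n ln 2 / m] the power is [4 exp(-y)], and [y exp(-y) <= 1/e]. *)
Lemma exp2_merge_bound (R : realType) (m n t : nat) :
  (0 < m)%N -> (n + t = m)%N ->
  n%:R * (2 `^ m%:R^-1) ^+ (2 * t) <= 2 * m%:R / (expR 1 * ln (2 : R)).
Proof.
move=> m0 nt; have [l1 _] := ln2_bounds R; have l0 : 0 < ln (2 : R) by lra.
have mR : 0 < m%:R :> R by rewrite ltr0n.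
have e0 := expR_gt0 (1 : R).
pose y : R := n%:R * 2 / m%:R * ln 2.
have -> : (2 `^ m%:R^-1) ^+ (2 * t) = 4 * expR (- y) :> R.
  rewrite exp2X natrM (_ : _ * _ = 2 - n%:R * 2 / m%:R); last first.
    by rewrite -nt natrD; field; rewrite -natrD nt lt0r_neq0.
  rewrite exp2D powR_mulrn // /powR pnatr_eq0 /= /y mulNr.
  by rewrite -natrX.
have hy : y <= expR (y - 1) by have := expR_ge1Dx (y - 1); lra.
rewrite expRD in hy.
have en : expR y * expR (- y) = 1 by rewrite -expRD subrr expR0.
have en1 : expR (1 : R) * expR (- 1) = 1 by rewrite -expRD subrr expR0.
rewrite ler_pdivlMr ?mulr_gt0 //.
have -> : n%:R * (4 * expR (- y)) * (expR 1 * ln 2)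
          = 2 * m%:R * (y * (expR (-y) * expR 1)).
  by rewrite /y; field; exact: lt0r_neq0.
rewrite -[leRHS]mulr1 ler_wpM2l ?mulr_ge0 ?ler0n //.
have : y * (expR (-y) * expR 1) <= expR y * expR (-1) * (expR (-y) * expR 1).
  by rewrite ler_wpM2r // mulr_ge0 // expR_ge0.
move/le_trans; apply; rewrite mulrACA en mul1r [_ * expR 1]mulrC en1 //.
Qed.

Lemma pow_sub1_le (R : realType) (a : R) (k : nat) : 1 <= a ->
  a * (a ^+ k - 1) <= k%:R * (a - 1) * a ^+ k.
Proof.
move=> a1; elim: k => [|k IH]; first by rewrite expr0 !mul0r subrr mulr0.
have : 1 <= a ^+ k by rewrite exprn_ege1.
rewrite exprS -natr1; move: (a ^+ k) (k%:R : R) (ler0n R k) IH => P K K0 IH P1.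
have : 0 <= a * (a - 1) * (P - 1) by rewrite !mulr_ge0; lra.
by nra.
Qed.

(** Used with [be = i/p] to absorb the factor [q^i] of the largest entry. With [b = 2^(1/n)] and
    [a = 2^(be/n)] the claim reads [(b - 1) a (a^(n-1) - 1) <= a - 1]. *)
Lemma exp2_sub1_scale (R : realType) (n : nat) (be : R) :
  (1 < n)%N -> 0 <= be -> be * n.-1%:R <= 1 ->
  2 `^ be * (2 `^ n%:R^-1 - 1) <= 2 `^ ((1 + be) / n%:R) - 1.
Proof.
case: n => // n n1 be0 be1; rewrite /= in be1.
set N : R := n.+1%:R; have N0 : 0 < N by rewrite ltr0n.
set b := 2 `^ N^-1; set a := 2 `^ (be / N).
have a1 : 1 <= a by rewrite exp2_ge1 // divr_ge0 // ltW.
have b1 : 1 <= b by rewrite exp2_ge1 // invr_ge0 ltW.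
have -> : (1 + be) / N = N^-1 + be / N by rewrite mulrDl mul1r.
rewrite exp2D -/a -/b.
have -> : 2 `^ be = a * a ^+ n.
  by rewrite -exprS exp2X -/N divfK // lt0r_neq0.
have ab : a ^+ n <= b.
  rewrite exp2X ler_powR ?ler1n // mulrAC -[leRHS]mul1r ler_wpM2r //.
  by rewrite invr_ge0 ltW.
have bN : N * (b - 1) <= 1.
  have iN : N^-1 <= 1 by rewrite invf_le1 // ler1n.
  have := @powR_le_chord R 2 N^-1 _ _ iN; rewrite -/b invr_ge0 ltW // => h.
  have := ler_wpM2l (ltW N0) (h (ltr0Sn _ _) isT).
  by rewrite mulrDr mulr1 mulrA divff ?lt0r_neq0 //; lra.
have h := pow_sub1_le _ _ n a1.
have K0 := ler0n R n.
have NE : N = n%:R + 1 by rewrite /N natr1.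
rewrite NE in bN.
move: (a ^+ n) (n%:R : R) ab bN h K0 => P K ab bN h K0.
have a0 : 0 <= a - 1 by lra.
have b0 : 0 <= b - 1 by lra.
(* [(K + 1)(b - 1) <= 1] gives [K (b - 1) <= 2 - b], and [b (2 - b) <= 1]. *)
have Kb : (b - 1) * K * b <= 1 by nra.
have h1 : (b - 1) * (a * (P - 1)) <= (b - 1) * (K * (a - 1) * b).
  by rewrite ler_wpM2l // (le_trans h) // ler_wpM2l // mulr_ge0.
have h2 := ler_wpM2r a0 Kb.
by nra.
Qed.

(** * The inequality between largest entry and prefix sum *)

(** Up to the factor [q/(q - 1)^2], the right side is the sum of [B] whole blocks and [c] entries of
    the next. The power of 2 is [q^(B + u)] with [u = c/n]; then [q^u <= 1 + u (q - 1)] and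
    [r^f >= 2^u >= u + 9/10]. *)
Lemma prefix_sum_lower (R : realType) (q r : R) (p m n i B f c : nat) :
  (0 < p)%N -> (0 < m)%N -> (0 < n)%N -> (c <= n)%N ->
  (B * n + c = p + i)%N -> (c * m <= f * n)%N ->
  q = 2 `^ p%:R^-1 -> r = 2 `^ m%:R^-1 ->
  2 `^ ((1 + i%:R / p%:R) / n%:R) - 1 - q ^+ B * (q - 1) / 10
    <= q ^+ B - 1 + q ^+ B * ((q - 1) * (r ^+ f - 1)).
Proof.
move=> p0 m0 n0 cn eB fn qE rE.
have pR : 0 < p%:R :> R by rewrite ltr0n.
have mR : 0 < m%:R :> R by rewrite ltr0n.
have nR : 0 < n%:R :> R by rewrite ltr0n.
pose u : R := c%:R / n%:R.
have u0 : 0 <= u by rewrite divr_ge0 // ler0n.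
have u1 : u <= 1 by rewrite ler_pdivrMr // mul1r ler_nat.
have q1 : 1 <= q by rewrite qE exp2_ge1 // invr_ge0 ltW.
have Q0 : 0 <= q ^+ B by rewrite exprn_ge0 //; lra.
have -> : 2 `^ ((1 + i%:R / p%:R) / n%:R) = q ^+ B * q `^ u :> R.
  rewrite qE exp2X -powRrM -exp2D; congr (_ `^ _).
  have -> : B%:R = (p%:R + i%:R - c%:R) / n%:R :> R.
    by rewrite -natrD -eB natrD addrK natrM mulfK // lt0r_neq0.
  by rewrite /u; field; rewrite !lt0r_neq0.
have qu : q `^ u <= 1 + u * (q - 1) by apply: powR_le_chord => //; lra.
have rf : u + 9 / 10 <= r ^+ f.
  apply: le_trans (exp2_ge_affine _ _ u0 u1) _.
  rewrite rE exp2X ler_powR ?ler1n // /u ler_pdivrMr // -mulrA ler_pdivlMl //.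
  by rewrite -!natrM ler_nat mulnC.
have h1 := ler_wpM2l Q0 qu.
have h2 : 0 <= q ^+ B * ((q - 1) * (r ^+ f - (u + 9 / 10))).
  by rewrite !mulr_ge0 //; lra.
by nra.
Qed.

(** The factor [1 - 1/p] serves the tight case [m = 2], where it pays for the truncated block; for
    [m >= 4] that loss is charged to the room left below [G]. *)
Lemma main_inequality (R : realType) (q r : R) (p m L n t i B f c : nat) :
  (256 <= p)%N -> p = (m * L)%N -> m = 2%N \/ (4 <= m)%N ->
  (n + t = m)%N -> (2 * t + 2 <= m)%N -> (c <= n)%N -> (i <= B)%N ->
  (B * n + c = p + i)%N -> (c * m <= f * n)%N ->
  q = 2 `^ p%:R^-1 -> r = 2 `^ m%:R^-1 ->
  (Num.sqrt 2 - 1) * (1 - p%:R^-1) * (q ^+ i * ((r ^+ 2 - 1) * r ^+ (2 * t)))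
    <= q ^+ B - 1 + q ^+ B * ((q - 1) * (r ^+ f - 1)).
Proof.
move=> p256 pmL hm nt tm cn iB eB fn qE rE.
have p0 : (0 < p)%N by lia.
have m0 : (0 < m)%N by lia.
have n0 : (0 < n)%N by lia.
have pR : 0 < p%:R :> R by rewrite ltr0n.
have mR : 0 < m%:R :> R by rewrite ltr0n.
have nR : 0 < n%:R :> R by rewrite ltr0n.
apply: le_trans (prefix_sum_lower _ _ _ _ _ _ _ _ _ _ p0 m0 n0 cn eB fn qE rE).
set G := 2 `^ _ - 1.
have L0 : (0 < L)%N by case: L pmL p0 {eB fn} => // ->; rewrite muln0.
have Ln : (L * n <= p + i)%N.
  by rewrite pmL mulnC (leq_trans _ (leq_addr _ _)) // leq_mul2r -nt leq_addr orbT.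
(* Either [r] is so close to 1 that the room exceeds the loss on the truncated
   block, or there are enough whole blocks to make that loss small. *)
have c64 : (64 <= m)%N \/ (4 <= L)%N.
  have [|m64] := leqP 64 m; [by left | right].
  by move: p256; clear -pmL m64; rewrite pmL; nia.
have ip : (i * n.-1 <= p)%N by nia.
have Bm : (B * m <= 2 * p)%N.
  have : (B * n.-1 <= m * L)%N by nia.
  have : (m <= 2 * n.-1)%N by lia.
  by rewrite pmL; clear; nia.
have q1 : 1 <= q by rewrite qE exp2_ge1 // invr_ge0 ltW.
have r1 : 1 <= r by rewrite rE exp2_ge1 // invr_ge0 ltW.
have qi1 : 1 <= q ^+ i by rewrite exprn_ege1.
have qBr : q ^+ B <= r ^+ 2.
  rewrite qE rE !exp2X ler_powR ?ler1n // ler_pdivrMl // mulrCA.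
  by rewrite -ler_pdivrMl ?invr_gt0 // invrK -!natrM ler_nat mulnC [leqRHS]mulnC.
have Gi : q ^+ i * (2 `^ n%:R^-1 - 1) <= G.
  rewrite qE exp2X (mulrC _ i%:R) /G; apply: exp2_sub1_scale; first by lia.
    by rewrite divr_ge0 // ler0n.
  by rewrite mulrAC ler_pdivrMr // mul1r -natrM ler_nat.
have [s1 s2] := sqrt2_bounds R.
have q_le : q - 1 <= p%:R^-1.
  have := @powR_le_chord R 2 p%:R^-1; rewrite invr_ge0 ltW // ltr0Sn.
  by rewrite invf_le1 // ler1n p0 => /(_ isT isT isT); rewrite -qE; clear; lra.
have ip0 : 0 < p%:R^-1 :> R by rewrite invr_gt0.
case: hm => [m2|m4].
  have t0 : t = 0%N by clear -tm m2; lia.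
  have n2 : n = 2%N by clear -nt t0 m2; lia.
  have rs : r = Num.sqrt 2 by rewrite rE m2 powR12_sqrt.
  have r2 : r ^+ 2 = 2 by rewrite rs sqr_sqrtr.
  rewrite n2 powR12_sqrt // in Gi.
  rewrite t0 muln0 expr0 mulr1 r2.
  (* The loss is thus at most [1/(5p)], less than the [(sqrt 2 - 1)/p] gained from the factor
     [1 - 1/p]. *)
  have h : q ^+ B * (q - 1) <= 2 * p%:R^-1.
    have Q2 : q ^+ B <= 2 by rewrite -r2.
    have Q0 : 0 <= q ^+ B by rewrite exprn_ge0 // (le_trans ler01).
    by apply: ler_pM => //; rewrite subr_ge0.
  have h2 : 0 <= (Num.sqrt 2 - 1) * p%:R^-1 * (q ^+ i - 1).
    by rewrite !mulr_ge0 //; lra.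
  have h3 : 0 <= (Num.sqrt (2 : R) - 1 - 1 / 5) * p%:R^-1 by rewrite mulr_ge0 //; lra.
  by clear - Gi h h2 h3; lra.
have T0 := exp2_merge_bound R _ _ _ m0 nt; rewrite -rE in T0.
(* [k (2^(1/k) - 1)] decreases in [k]: the chord bound is applied to [r = (2^(1/n))^(n/m)]. *)
have b1 : m%:R * (r - 1) <= n%:R * (2 `^ n%:R^-1 - 1).
  have := @powR_le_chord R (2 `^ n%:R^-1) (n%:R / m%:R).
  rewrite powR_gt0 // divr_ge0 ?ler0n // ler_pdivrMr // mul1r ler_nat.
  rewrite -powRrM mulrA mulVf ?lt0r_neq0 // mul1r -rE => /(_ isT isT).
  have -> : (n <= m)%N by rewrite -nt leq_addr.
  move=> /(_ isT) h; rewrite -ler_pdivlMl // mulrA [_^-1 * _]mulrC; lra.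
(* [G + 1 = q^B'] for the real exponent [B' = (p + i)/n >= L], so the chord bound measures [q - 1],
   hence the loss, against [G]. *)
have LG : L%:R * (q - 1) <= G.
  pose B' : R := (p + i)%:R / n%:R.
  have LB : L%:R <= B'.
    by rewrite ler_pdivlMr // -natrM ler_nat.
  have L1 : 1 <= L%:R :> R by rewrite ler1n.
  have := @powR_le_chord R (2 `^ (p%:R^-1 * B')) B'^-1.
  rewrite powR_gt0 // invr_ge0 -powRrM mulfK ?lt0r_neq0 //; [|lra].
  rewrite invf_le1; last by lra.
  have -> : 0 <= B' by lra.
  have -> : 1 <= B' by lra.
  move=> /(_ isT isT isT).
  have -> : p%:R^-1 * B' = (1 + i%:R / p%:R) / n%:R :> R.
    by rewrite /B' natrD; field; rewrite !lt0r_neq0.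
  rewrite -qE -/G => h.
  have h2 : B' * (q - 1) <= G.
    by rewrite -ler_pdivlMl; lra.
  by apply: le_trans h2; rewrite ler_wpM2r //; lra.
have l1 := (ln2_bounds R).1; have e1 := expR1_ge R.
have l0 : 0 < ln (2 : R) by clear -l1; lra.
have e0 : 0 < expR (1 : R) by exact: expR_gt0.
(* The left side is about 1.0615. *)
have kap : 2 / (expR 1 * ln (2 : R)) <= 531 / 500.
  rewrite ler_pdivrMr ?mulr_gt0 //; clear -l1 e1; nra.
set T := r ^+ (2 * t) in T0 *.
have T1 : n%:R * T <= m%:R * (531 / 500).
  by apply: le_trans T0 _; rewrite [2 * _]mulrC -mulrA ler_wpM2l // ler0n.
have Tb : T * (r - 1) <= 531 / 500 * (2 `^ n%:R^-1 - 1).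
  rewrite -(ler_pM2l (mulr_gt0 nR mR)).
  have r0 : 0 <= m%:R * (r - 1) by rewrite mulr_ge0 ?ler0n ?subr_ge0.
  have h1 := ler_wpM2r r0 T1.
  have h2 := ler_wpM2l (mulr_ge0 (ler0n R m) (ler0n R 531)) b1.
  by clear - h1 h2; lra.
(* [K G] will bound the left side, with [29/70] in place of [sqrt 2 - 1]; [key] says that the rest
   of [G] covers the loss. *)
pose K : R := 29 / 70 * (531 / 500) * (r + 1).
have LR : 0 < L%:R :> R by rewrite ltr0n.
have key : K + r ^+ 2 / (10 * L%:R) <= 1.
  have split_L (k : nat) : (0 < k <= L)%N ->
      r ^+ 2 / (10 * L%:R) <= r ^+ 2 / (10 * k%:R).
    move=> /andP[k0 kL]; rewrite ler_wpM2l ?sqr_ge0 //.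
    by rewrite lef_pV2 ?posrE ?mulr_gt0 ?ltr0n // ler_pM2l // ler_nat.
  case: c64 => [m64|L4].
    have rm : r <= 1 + m%:R^-1.
      have := @powR_le_chord R 2 m%:R^-1; rewrite invr_ge0 ltW // ltr0Sn.
      by rewrite invf_le1 // ler1n m0 -rE => /(_ isT isT isT); clear; lra.
    have m64R : m%:R^-1 <= 1 / 64 :> R.
      by rewrite div1r lef_pV2 ?posrE ?ltr0n // ler_nat.
    have r2 : r <= 65 / 64 by clear -rm m64R; lra.
    apply: le_trans (lerD (lexx _) (split_L 1%N _)) _; first by rewrite L0.
    by rewrite /K; clear -r1 r2; nra.
  have r4 : r ^+ 4 <= 2.
    rewrite rE exp2X -[leRHS](powRr1 (ler0n R 2)) ler_powR ?ler1n //.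
    by rewrite ler_pdivrMl // mulr1 ler_nat.
  have r2 : r <= 119 / 100.
    rewrite leNgt; apply/negP => rlt.
    have : (119 / 100) ^+ 4 < r ^+ 4 by rewrite ltrXn2r.
    by clear -r4; lra.
  apply: le_trans (lerD (lexx _) (split_L 4%N _)) _; first by rewrite L4.
  by rewrite /K; clear -r1 r2; nra.
have G0 : 0 <= G.
  by apply: le_trans LG; rewrite mulr_ge0 ?ler0n ?subr_ge0.
have QG : q ^+ B * (q - 1) / 10 <= r ^+ 2 / (10 * L%:R) * G.
  have -> : r ^+ 2 / (10 * L%:R) * G = r ^+ 2 * (L%:R^-1 * G) / 10.
    by field; exact: lt0r_neq0.
  rewrite ler_wpM2r // ler_pM // ?subr_ge0 // ?exprn_ge0 // ?(le_trans ler01) //.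
  by rewrite ler_pdivlMl.
have VK : (Num.sqrt 2 - 1) * (q ^+ i * ((r ^+ 2 - 1) * T)) <= K * G.
  have -> : (Num.sqrt 2 - 1) * (q ^+ i * ((r ^+ 2 - 1) * T)) =
     (Num.sqrt 2 - 1) * (r + 1) * (q ^+ i * (T * (r - 1))) by ring.
  have T00 : 0 <= T by rewrite exprn_ge0 // (le_trans ler01).
  have -> : K * G = 29 / 70 * (r + 1) * (531 / 500 * G) by rewrite /K; ring.
  apply: ler_pM.
  - by rewrite mulr_ge0 //; clear -s1 r1; lra.
  - by rewrite !mulr_ge0 // ?subr_ge0 // (le_trans ler01).
  - by rewrite ler_wpM2r //; clear -s2 r1; lra.
  have qi0 : 0 <= q ^+ i by rewrite (le_trans ler01).
  by have := ler_wpM2l qi0 Tb; clear -Gi; lra.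
have V0 : 0 <= (Num.sqrt 2 - 1) * (q ^+ i * ((r ^+ 2 - 1) * T)).
  rewrite !mulr_ge0 ?subr_ge0 ?exprn_ege1 ?exprn_ge0 ?(le_trans ler01) //.
  by clear -s1; lra.
have KG := ler_wpM2r G0 key.
have := mulr_ge0 V0 (ltW ip0).
by clear -VK KG QG; lra.
Qed.

(** * Merging inside one block *)

Lemma adjacent_sums_mkseq (R : realType) (f : nat -> R) (n : nat) :
  adjacent_sums (mkseq f n) = mkseq (fun j => f j + f j.+1) n.-1.
Proof.
case: n => // n; rewrite /mkseq -[n.+1]add1n iotaD /=.
apply: (@eq_from_nth _ 0); rewrite size_pairmap !size_map !size_iota // => j jn.
rewrite (nth_pairmap 0) ?size_map ?size_iota //.
rewrite !(nth_map 0%N) ?size_iota // !nth_iota // add0n add1n.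
congr (_ + _); case: j jn => //= j jn.
by rewrite (nth_map 0%N) ?size_iota 1?ltnW // nth_iota 1?ltnW.
Qed.

(** Ties go to the leftmost pair, hence the strict inequality to the left of [k] only. *)
Lemma merge_next_mkseq (R : realType) (f : nat -> R) (n k : nat) :
  (k.+1 < n)%N ->
  (forall j, (j.+1 < n)%N -> f k + f k.+1 <= f j + f j.+1) ->
  (forall j, (j < k)%N -> f k + f k.+1 < f j + f j.+1) ->
  merge_next (mkseq f n) =
    mkseq (fun j => if (j < k)%N then f j
                    else if j == k then f k + f k.+1 else f j.+1) n.-1.
Proof.
move=> kn fmin flt.
have -> : merge_next (mkseq f n) = take k (mkseq f n)
    ++ ((mkseq f n)`_k + (mkseq f n)`_k.+1) :: drop k.+2 (mkseq f n).
  suff mk : min_pair (mkseq f n) = k by rewrite /merge_next mk.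
  rewrite /min_pair adjacent_sums_mkseq.
  set g := fun j => f j + f j.+1; set P := fun m : R => all _ _.
  have Pk : P (g k).
    apply/allP => y /mapP[j]; rewrite mem_iota => /andP[_ jn] ->.
    by apply: fmin; lia.
  have kn' : (k < n.-1)%N by lia.
  apply/eqP; rewrite eqn_leq; apply/andP; split.
    rewrite leqNgt; apply/negP => /(before_find 0).
    by rewrite nth_mkseq // Pk.
  rewrite leqNgt; apply/negP => kf.
  have hP : has P (mkseq g n.-1).
    by apply/hasP; exists (g k) => //; apply/mapP; exists k; rewrite ?mem_iota.
  have := nth_find 0 hP; rewrite nth_mkseq; last exact: ltn_trans kf kn'.
  move/allP => /(_ (g k)) -/(_ _); rewrite leNgt flt // => H.
  by have : false by apply: H; apply/mapP; exists k; rewrite ?mem_iota.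
apply: (@eq_from_nth _ 0).
  rewrite size_cat /= size_takel ?size_drop ?size_mkseq; lia.
move=> j; rewrite size_cat /= size_takel ?size_drop ?size_mkseq => [jn|]; last by lia.
rewrite nth_cat size_takel ?size_mkseq; last by lia.
rewrite [RHS]nth_mkseq; last by lia.
have [jk|kj] := ltnP j k; first by rewrite nth_take // nth_mkseq //; lia.
have [->|jk] := eqVneq j k; first by rewrite subnn /= !nth_mkseq //; lia.
have -> : (j - k = (j - k.+1).+1)%N by lia.
by rewrite /= nth_drop nth_mkseq; [congr f|]; lia.
Qed.

(* Once the level-[m] entries [a (r^(k+1) - r^k)], [k < m], have undergone [t]
   merges, the [k]-th entry is [a (r^(bp t (k+1)) - r^(bp t k))]. *)
Definition breakpoint (t k : nat) : nat := minn (2 * k) (k + t).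

Definition merged_block {R : realType} (a r : R) (m t : nat) : seq R :=
  mkseq (fun k => a * (r ^+ breakpoint t k.+1 - r ^+ breakpoint t k)) (m - t).

(** The pair at [t] sums to [a (r^2 - 1) r^(2t)]. Pairs to its right are unmerged, with increasing
    sums. To its left, two merged entries sum to [a (r^4 - 1) r^(2j)], which is larger since
    [r^2 + 1 > 2 >= r^(2t)]. *)
Lemma merge_next_block (R : realType) (a r : R) (m t : nat) :
  0 < a -> 1 < r -> r ^+ m = 2 -> (2 * t + 2 <= m)%N ->
  merge_next (merged_block a r m t) = merged_block a r m t.+1.
Proof.
move=> a0 r1 rm tm; rewrite /merged_block.
have r1' := ltW r1.
have gE j : a * (r ^+ breakpoint t j.+1 - r ^+ breakpoint t j)
    + a * (r ^+ breakpoint t j.+2 - r ^+ breakpoint t j.+1)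
    = a * (r ^+ breakpoint t j.+2 - r ^+ breakpoint t j) by ring.
have bt : breakpoint t t = (2 * t)%N by rewrite /breakpoint; lia.
have bt2 : breakpoint t t.+2 = (2 * t + 2)%N by rewrite /breakpoint; lia.
have lt_left j : (j < t)%N ->
    r ^+ breakpoint t t.+2 - r ^+ breakpoint t t
      < r ^+ breakpoint t j.+2 - r ^+ breakpoint t j.
  move=> jt; rewrite bt bt2.
  have -> : breakpoint t j = (2 * j)%N by rewrite /breakpoint; lia.
  (* The mixed pair, last merged and first unmerged entry: here [r + 1 > 2 >= r^3] decides. *)
  have [jt1|jt1] := eqVneq j.+1 t.
    have -> : breakpoint t j.+2 = (2 * j + 3)%N by rewrite /breakpoint; lia.
    have -> : (2 * t = 2 * j + 2)%N by lia.
    have r3 : r ^+ 3 <= 2 by rewrite -rm ler_weXn2l //; lia.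
    move: (2 * j)%N => d; have P0 : 0 < r ^+ d by rewrite exprn_gt0 //; lra.
    rewrite -addnA !exprD; move: (r ^+ d) P0 => P P0.
    have : 0 < P * ((r - 1) * (r + 1 - r ^+ 3)) by rewrite !mulr_gt0 //; lra.
    by clear; lra.
  have -> : breakpoint t j.+2 = (2 * j + 4)%N by rewrite /breakpoint; lia.
  have rt : r ^+ (2 * t) <= 2 by rewrite -rm ler_weXn2l //; lia.
  move: (2 * t)%N (2 * j)%N rt => c d rt.
  have P1 : 1 <= r ^+ d by rewrite exprn_ege1.
  rewrite !exprD; move: (r ^+ d) (r ^+ c) P1 rt => P Q P1 Q2.
  have r2 : 0 < r ^+ 2 - 1 by rewrite subr_gt0 exprn_egt1.
  have h1 : 0 <= (r ^+ 2 - 1) * (2 - Q) by rewrite mulr_ge0 //; lra.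
  have h2 : 0 <= (P - 1) * ((r ^+ 2 - 1) * (r ^+ 2 + 1)).
    by rewrite !mulr_ge0 //; lra.
  have h3 : 0 < (r ^+ 2 - 1) * (r ^+ 2 - 1) by rewrite mulr_gt0.
  by clear -h1 h2 h3; lra.
rewrite (@merge_next_mkseq _ _ _ t).
- have -> : ((m - t).-1 = m - t.+1)%N by lia.
  apply: eq_mkseq => j; have [jt|tj] := ltnP j t.
    by congr (a * (r ^+ _ - r ^+ _)); rewrite /breakpoint; lia.
  have [->|jt] := eqVneq j t.
    by rewrite gE; congr (a * (r ^+ _ - r ^+ _)); rewrite /breakpoint; lia.
  by congr (a * (r ^+ _ - r ^+ _)); rewrite /breakpoint; lia.
- by lia.
- move=> j jm; rewrite !gE ler_pM2l //.
  have [/lt_left/ltW //|tj] := ltnP j t.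
  have -> : breakpoint t j.+2 = (j + t + 2)%N by rewrite /breakpoint; lia.
  have -> : breakpoint t j = (j + t)%N by rewrite /breakpoint; lia.
  have : r ^+ (2 * t) <= r ^+ (j + t) by rewrite ler_weXn2l //; lia.
  rewrite bt bt2; move: (2 * t)%N (j + t)%N => c d cd; rewrite !exprD.
  have h : 0 <= r ^+ 2 - 1 by rewrite subr_ge0 exprn_ege1.
  by have := ler_wpM2r h cd; clear; lra.
- by move=> j jt; rewrite !gE ltr_pM2l // lt_left.
Qed.

Lemma merged_block_half (R : realType) (a r : R) (m : nat) :
  merged_block a r (2 * m) m = merged_block a (r ^+ 2) m 0.
Proof.
rewrite /merged_block subn0 (_ : (2 * m - m = m)%N); last by lia.
apply/eq_in_map => k; rewrite mem_iota add0n => km.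
rewrite -!exprM; congr (a * (r ^+ _ - r ^+ _)); rewrite /breakpoint; lia.
Qed.

Lemma super_partition_init_block (R : realType) (p b : nat) (q : R) :
  (0 < p)%N -> q = 2 `^ p%:R^-1 -> 1 < q ->
  super_partition_init p 2 b = merged_block (q ^+ b / (q - 1)) q p 0.
Proof.
move=> p0 qE q1; rewrite /super_partition_init /merged_block subn0.
apply: eq_mkseq => k.
have -> : breakpoint 0 k.+1 = k.+1 by rewrite /breakpoint; lia.
have -> : breakpoint 0 k = k by rewrite /breakpoint; lia.
have -> : 2 `^ ((b + k)%:R / p%:R) = q ^+ (b + k) :> R.
  by rewrite qE -powR_mulrn ?powR_ge0 // -powRrM mulrC.
by rewrite exprD exprS; field; lra.
Qed.

(** The same [m], [L], [t] serve all bases, and both [N] and [N + 1] merges, since during a round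
    some super-partitions are one merge ahead. The condition [2 t + 2 <= m] leaves room for that
    merge at the same level. *)
Lemma iter_merge_next_block (R : realType) (p e N : nat) (q : R) :
  p = (2 ^ e)%N -> q = 2 `^ p%:R^-1 -> (N.+1 < p)%N ->
  exists m L t : nat, [/\ p = (m * L)%N, m = 2%N \/ (4 <= m)%N,
    (2 * t + 2 <= m)%N &
    forall b s : nat, (s <= 1)%N ->
      iter (N + s) (@merge_next R) (super_partition_init p 2 b)
        = merged_block (q ^+ b / (q - 1)) (q ^+ L) m (t + s)].
Proof.
move=> pe qE; have p0 : (0 < p)%N by rewrite pe expn_gt0.
have q1 : 1 < q by rewrite qE exp2_gt1 // invr_gt0 ltr0n.
have qp : q ^+ p = 2.
  by rewrite qE -powR_mulrn ?powR_ge0 // -powRrM mulVf ?powRr1 // pnatr_eq0 -lt0n.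
have a0 b : 0 < q ^+ b / (q - 1).
  by rewrite divr_gt0 ?exprn_gt0 ?subr_gt0 // (lt_trans ltr01).
(* The equation [N + 2^j = p + t] counts the entries left; it ensures that a new level starts with
   at least two. *)
suff H : (N.+1 < p)%N -> exists j l t : nat, [/\ (j + l = e)%N,
    (2 * t + 2 <= 2 ^ j)%N, (N + 2 ^ j = p + t)%N & forall b,
    iter N (@merge_next R) (super_partition_init p 2 b)
        = merged_block (q ^+ b / (q - 1)) (q ^+ (2 ^ l)) (2 ^ j) t].
  move=> /H[j [l [t [jl tj _ HN]]]]; exists (2 ^ j)%N, (2 ^ l)%N, t; split => //.
  - by rewrite -expnD jl.
  - case: j tj {jl HN} => [|[|j]] tj; [by rewrite expn0 in tj; lia|by left|right].
    have : (0 < 2 ^ j)%N by [rewrite expn_gt0]; rewrite !expnS; lia.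
  - move=> b [|[|s]] // _; first by rewrite !addn0.
    rewrite !addn1 iterS HN merge_next_block ?exprn_egt1 //.
      by rewrite -lt0n expn_gt0.
    by rewrite -exprM -expnD addnC jl -pe.
elim: N => [|N IH] Np.
  case: e pe => [|e] pe; first by rewrite pe in Np.
  exists e.+1, 0%N, 0%N; split; rewrite ?addn0 ?add0n //.
    by have : (0 < 2 ^ e)%N by [rewrite expn_gt0]; rewrite expnS; lia.
  by move=> b; rewrite -pe expr1; exact: super_partition_init_block.
have [j [l [t [jl tj Nt HN]]]] := IH (ltnW Np).
have HS b : iter N.+1 (@merge_next R) (super_partition_init p 2 b)
    = merged_block (q ^+ b / (q - 1)) (q ^+ (2 ^ l)) (2 ^ j) t.+1.
  rewrite iterS HN merge_next_block ?exprn_egt1 //.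
    by rewrite -lt0n expn_gt0.
  by rewrite -exprM -expnD addnC jl -pe.
have [t2|t2] := leqP (2 * t.+1 + 2) (2 ^ j).
  by exists j, l, t.+1; split => //; lia.
case: j => [|j] in jl tj Nt HN HS t2 *; first by lia.
(* The level is complete: the next one has half the entries, ratio [r^2] and [t = 0]. *)
have tE : t.+1 = (2 ^ j)%N by move: tj t2; rewrite expnS; lia.
exists j, l.+1, 0%N; split.
- by lia.
- have : (0 < 2 ^ j)%N by [rewrite expn_gt0]; move: Nt; rewrite expnS.
  case: j tE {jl tj HN HS t2} => [|j]; rewrite ?expnS; lia.
- by move: Nt; rewrite expnS; lia.
- by move=> b; rewrite HS tE expnS merged_block_half -exprM -expnSr.
Qed.

(** * Prefixes, block totals and crude bounds *)

(** A prefix ending at a boundary takes [c] to be the full length of its last sequence, so that [B]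
    remains a valid index. *)
Lemma take_flatten (T : Type) (p : nat) (ss : seq (seq T)) :
  (0 < size ss)%N -> (p <= size (flatten ss))%N ->
  exists B c : nat, [/\ (B < size ss)%N, (c <= size (nth [::] ss B))%N,
    take p (flatten ss) = flatten (take B ss) ++ take c (nth [::] ss B) &
    (size (flatten (take B ss)) + c = p)%N].
Proof.
elim: ss p => // s ss IH p _ /= ps.
have [sp|sp] := leqP p (size s).
  by exists 0%N, p; split => //=; rewrite takel_cat.
rewrite size_cat in ps.
have ss0 : (0 < size ss)%N by case: ss ps {IH} => //=; lia.
have [|B [c [h1 h2 h3 h4]]] := IH (p - size s)%N ss0; first by lia.
exists B.+1, c; split => //=.
  by rewrite take_cat ltnNge (ltnW sp) /= h3 catA.
by rewrite size_cat; lia.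
Qed.

Lemma sum_take_block (R : realType) (a r : R) (m t c : nat) :
  (c <= m - t)%N ->
  \sum_(x <- take c (merged_block a r m t)) x = a * (r ^+ breakpoint t c - 1).
Proof.
move=> cm; rewrite /merged_block /mkseq -map_take take_iota (minn_idPl cm).
rewrite big_map; elim: c {cm} => [|c IH].
  by rewrite big_nil /breakpoint muln0 min0n expr0 subrr mulr0.
by rewrite -addn1 iotaD big_cat IH /= big_seq1 add0n addn1; ring.
Qed.

Lemma sum_block (R : realType) (a r : R) (m t : nat) :
  (2 * t <= m)%N -> r ^+ m = 2 -> \sum_(x <- merged_block a r m t) x = a.
Proof.
move=> tm rm; rewrite -(@take_oversize _ (m - t)%N (merged_block a r m t)); last by rewrite size_mkseq.
rewrite sum_take_block // (_ : breakpoint t (m - t) = m); last first.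
  by rewrite /breakpoint; lia.
by rewrite rm; ring.
Qed.

Lemma merge_next_ge0 (R : realType) (s : seq R) :
  (forall x, x \in s -> 0 <= x) -> forall x, x \in merge_next s -> 0 <= x.
Proof.
move=> s0 x; rewrite /merge_next mem_cat inE.
have n0 k : 0 <= s`_k.
  by have [ks|ks] := ltnP k (size s); [exact/s0/mem_nth|rewrite nth_default].
by case/or3P => [/mem_take/s0 //|/eqP ->|/mem_drop/s0 //]; rewrite addr_ge0.
Qed.

Lemma iter_merge_next_ge0 (R : realType) (p N b : nat) (x : R) :
  x \in iter N (@merge_next R) (super_partition_init p 2 b) -> 0 <= x.
Proof.
elim: N x => [|N IH] x /=; last exact: merge_next_ge0.
by case/mapP => k _ ->; exact: powR_ge0.
Qed.

Lemma max_entry_le (R : realType) (X : seq R) (M : R) :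
  0 <= M -> (forall x, x \in X -> x <= M) -> max_entry X <= M.
Proof.
by move=> M0 XM; rewrite /max_entry big_seq; elim/big_ind: _ => // x y; rewrite ge_max => -> ->.
Qed.

(** The maximum is at most the sum. This crude bound settles small [p]. *)
Lemma max_avg_le_size (R : realType) (X : seq R) :
  (forall x, x \in X -> 0 <= x) -> max_entry X / avg_entry X <= (size X)%:R.
Proof.
move=> X0; rewrite /avg_entry invf_div mulrCA.
have S0 : 0 <= \sum_(a <- X) a by rewrite big_seq sumr_ge0.
have MS : max_entry X <= \sum_(a <- X) a.
  apply: max_entry_le => // x xX.
  rewrite (big_rem x) //= lerDl big_seq sumr_ge0 // => y /mem_rem; exact: X0.
have [->|S1] := eqVneq (\sum_(a <- X) a) 0; first by rewrite invr0 !mulr0 ler0n.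
rewrite ler_piMr ?ler0n // ler_pdivrMr ?mul1r //.
by rewrite lt_neqAle eq_sym S1.
Qed.

(** * Vectors produced by the scheme *)

(** The state after [N] full rounds and [i] steps of the next; the boolean counts as the extra
    merge. *)
Definition round_blocks {R : realType} (p N i : nat) : seq (seq R) :=
  [seq iter (N + (b <= i)%N) (@merge_next R) (super_partition_init p 2 b)
    | b <- iota 1 p].

Lemma set_nth_round_blocks (R : realType) (p N i : nat) : (i < p)%N ->
  set_nth [::] (@round_blocks R p N i) i
    (merge_next (nth [::] (round_blocks p N i) i)) = round_blocks p N i.+1.
Proof.
move=> ip; apply: (@eq_from_nth _ [::]).
  by rewrite size_set_nth !size_map !size_iota; lia.
move=> k; rewrite size_set_nth !size_map size_iota (maxn_idPr ip) => kp.
rewrite nth_set_nth /= !(nth_map 0%N) ?size_iota // !nth_iota // !add1n.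
have [->|ki] := eqVneq k i.
  by rewrite ltnn ltnSn addn0 addn1 iterS.
by have -> : (k < i.+1)%N = (k < i)%N by lia.
Qed.

(** Every vector kept is the initial one or was read off some state. The [maxn 1] covers [p = 1],
    where there is no round but still an initial vector. *)
Lemma periodic_scheme_mem (R : realType) (p : nat) (X : seq R) :
  (0 < p)%N -> X \in periodic_scheme p 2 ->
  exists N i : nat, [/\ (N < maxn 1 p.-1)%N, (i <= p)%N &
    X = take p (flatten (round_blocks p N i))].
Proof.
move=> p0; pose good (X : seq R) := exists N i : nat,
  [/\ (N < maxn 1 p.-1)%N, (i <= p)%N & X = take p (flatten (round_blocks p N i))].
have round0 N : @round_blocks R p N p = round_blocks p N.+1 0.
  apply/eq_in_map => b; rewrite mem_iota add1n ltnS => /andP[b1 bp].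
  by rewrite bp leqNgt b1 addn1 addn0.
suff H N : (N <= p.-1)%N ->
    let st := iter N (scheme_round p) (scheme_init p (2 : R)) in
    st.1 = round_blocks p N 0 /\ (forall X, X \in st.2 -> good X).
  by have [_] := H p.-1 (leqnn _); apply.
elim: N => [|N IH] Np /=.
  split.
    apply/eq_in_map => b; rewrite mem_iota => /andP[b1 _].
    by rewrite leqNgt b1.
  move=> Y; rewrite inE => /eqP ->; exists 0%N, 0%N; split => //.
    by rewrite leq_max.
  case: p p0 {Np round0 good} => // p _.
  by rewrite /round_blocks /= takel_cat ?take_oversize ?size_map ?size_iota.
have [] := IH (ltnW Np); move: (iter N _ _) => [Ss Xs] /= SsE XsG.
suff H i : (i <= p)%N ->
    let st := foldl (scheme_step p) (Ss, Xs) (iota 1 i) in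
    st.1 = round_blocks p N i /\ (forall X, X \in st.2 -> good X).
  by rewrite -round0; exact: H.
elim: i => [|i IHi] ip; first by [].
rewrite -[i.+1]addn1 iotaD foldl_cat addn1 add1n.
have [] := IHi (ltnW ip); move: (foldl _ _ _) => [Ss' Xs'] /= S1 X1.
rewrite S1 set_nth_round_blocks //; split => // Y.
case: ifP => _; last exact: X1.
rewrite mem_rcons inE => /orP[/eqP ->|/X1 //].
by exists N, i.+1; split => //; rewrite leq_max; apply/orP; right.
Qed.

(** * Size, sum and largest entry of such a vector *)

Lemma size_flatten_blocks (R : realType) (a : nat -> R) (r : R) (m t i B : nat) :
  (t < m)%N ->
  (size (flatten [seq merged_block (a b) r m (t + (b <= i)%N) | b <- iota 1 B])
     + minn B i = B * (m - t))%N.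
Proof.
move=> tm; elim: B => [|B IH]; first by rewrite min0n.
rewrite -[X in iota _ X]addn1 iotaD map_cat flatten_cat size_cat /= cats0.
rewrite size_mkseq add1n mulSn -IH; case: (ltnP B i) => Bi; lia.
Qed.

(** Merging keeps the total [q^b/(q - 1)] of each block, which leaves a geometric sum in [b]. *)
Lemma sum_flatten_blocks (R : realType) (q r : R) (m t i B : nat) :
  1 < q -> r ^+ m = 2 -> (2 * t + 2 <= m)%N ->
  \sum_(x <- flatten [seq merged_block (q ^+ b / (q - 1)) r m (t + (b <= i)%N)
                     | b <- iota 1 B]) x = q * (q ^+ B - 1) / (q - 1) ^+ 2.
Proof.
move=> q1 rm tm; elim: B => [|B IH].
  by rewrite big_nil expr0 subrr mulr0 mul0r.
rewrite -[X in iota _ X]addn1 iotaD map_cat flatten_cat big_cat IH /= cats0.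
rewrite sum_block //; last by case: leqP; lia.
by rewrite add1n !exprS; field; lra.
Qed.

(** The bound is the entry merged last. An unmerged entry is [a (r - 1) P] with
    [P <= 2 <= r + 1]. *)
Lemma block_succ_entry_le (R : realType) (a r : R) (m t : nat) (x : R) :
  0 <= a -> 1 < r -> r ^+ m = 2 -> (2 * t + 2 <= m)%N ->
  x \in merged_block a r m t.+1 -> x <= a * ((r ^+ 2 - 1) * r ^+ (2 * t)).
Proof.
move=> a0 r1 rm tm /mapP[k]; rewrite mem_iota add0n => /andP[_ km] ->.
rewrite ler_wpM2l //; have r1' := ltW r1.
have r2 : 0 <= r ^+ 2 - 1 by rewrite subr_ge0 exprn_ege1.
have [kt|tk] := ltnP k t.+1.
  have -> : breakpoint t.+1 k.+1 = (2 + 2 * k)%N by rewrite /breakpoint; lia.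
  have -> : breakpoint t.+1 k = (2 * k)%N by rewrite /breakpoint; lia.
  have : r ^+ (2 * k) <= r ^+ (2 * t) by rewrite ler_weXn2l //; lia.
  move: (2 * k)%N (2 * t)%N => c d /(ler_wpM2l r2); rewrite exprD.
  by clear; lra.
have -> : breakpoint t.+1 k.+1 = (k + t.+1).+1 by rewrite /breakpoint; lia.
have -> : breakpoint t.+1 k = (k + t.+1)%N by rewrite /breakpoint; lia.
have : r ^+ (k + t.+1).+1 <= 2 by rewrite -rm ler_weXn2l //; lia.
have : 1 <= r ^+ (2 * t) by rewrite exprn_ege1.
rewrite exprS; move: (r ^+ _) (r ^+ (2 * t)) => P Q Q1 P1.
have P2 : P <= 2 by clear -P1 r1; nra.
have h1 : 0 <= (r ^+ 2 - 1) * (Q - 1) by rewrite mulr_ge0 //; lra.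
have h2 : 0 <= (r - 1) * (r + 1 - P) by rewrite mulr_ge0 //; lra.
by clear -h1 h2; lra.
Qed.

(** For blocks still awaiting their merge in the current round: the spare factor [r], or [r^2] when
    [t > 0], will offset their larger base. *)
Lemma block_entry_le (R : realType) (a r : R) (m t : nat) (x : R) :
  0 <= a -> 1 < r -> r ^+ m = 2 -> (2 * t + 2 <= m)%N ->
  x \in merged_block a r m t ->
  r ^+ (t != 0%N).+1 * x <= a * ((r ^+ 2 - 1) * r ^+ (2 * t)).
Proof.
move=> a0 r1 rm tm /mapP[k]; rewrite mem_iota add0n => /andP[_ km] ->.
rewrite mulrCA ler_wpM2l //; have r1' := ltW r1.
have r2 : 0 <= r ^+ 2 - 1 by rewrite subr_ge0 exprn_ege1.
have [kt|tk] := ltnP k t.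
  have -> : (t != 0)%N = true by lia.
  have -> : breakpoint t k.+1 = (2 + 2 * k)%N by rewrite /breakpoint; lia.
  have -> : breakpoint t k = (2 * k)%N by rewrite /breakpoint; lia.
  have : r ^+ (2 + 2 * k) <= r ^+ (2 * t) by rewrite ler_weXn2l //; lia.
  move: (2 * k)%N (2 * t)%N => c d /(ler_wpM2l r2); rewrite exprD.
  by clear; lra.
have -> : breakpoint t k.+1 = (k + t).+1 by rewrite /breakpoint; lia.
have -> : breakpoint t k = (k + t)%N by rewrite /breakpoint; lia.
have : r ^+ (k + t).+1 <= 2 by rewrite -rm ler_weXn2l //; lia.
rewrite exprS; move: (r ^+ (k + t)) => P P1.
have h1 : 0 <= (r - 1) * (2 - r * P) by rewrite mulr_ge0 //; lra.
have [t0|t0] /= := eqVneq t 0%N.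
  have h2 : 0 <= (r - 1) * (r - 1) by rewrite mulr_ge0 //; lra.
  by rewrite t0 muln0 expr0 expr1; clear -h1 h2; lra.
have : r ^+ 2 <= r ^+ (2 * t) by rewrite ler_weXn2l //; lia.
move: (r ^+ (2 * t)) => Q Q1.
have h2 : 0 <= (r ^+ 2 - 1) * (Q - r ^+ 2) by rewrite mulr_ge0 //; lra.
have h3 : 0 <= r * ((r - 1) * (2 - r * P)) by rewrite mulr_ge0 //; lra.
have h4 : 0 <= r * ((r - 1) * ((r + 2) * (r - 1))) by rewrite !mulr_ge0 //; lra.
by clear -h2 h3 h4; lra.
Qed.

(** * Assembling the bound *)

(** [p (2^(1/p) - 1)] tends to [ln 2] from above; the factor [1 - 1/p] absorbs the excess, by
    [2^(-1/p) >= 1 - ln 2 / p]. *)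
Lemma root2_sub1_le (R : realType) (p : nat) : (0 < p)%N ->
  (2 `^ p%:R^-1 - 1) * p%:R * (1 - p%:R^-1) <= ln 2 :> R.
Proof.
move=> p0; have pR : 0 < p%:R :> R by rewrite ltr0n.
have i0 : 0 < p%:R^-1 :> R by rewrite invr_gt0.
have i1 : p%:R^-1 <= 1 :> R by rewrite invf_le1 // ler1n.
have [l1 l2] := ln2_bounds R.
have q1 := @exp2_ge1 R _ (ltW i0).
have h : 2 `^ p%:R^-1 * (1 - p%:R^-1 * ln 2) <= 1 :> R.
  rewrite -ler_pdivlMl ?powR_gt0 // mulr1 -powRN /powR pnatr_eq0 /= mulNr.
  by rewrite (le_trans _ (expR_ge1Dx _)).
rewrite mulrAC -ler_pdivlMr //; move: i0 i1 q1 h; set P : R := p%:R^-1; set q : R := 2 `^ P => i0 i1 q1 h.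
have h2 : 0 <= P * ((1 - ln 2) * (q - 1)) by rewrite !mulr_ge0 //; lra.
by clear -h h2; lra.
Qed.

Lemma max_avg_round_blocks (R : realType) (p e N i : nat) (X : seq R) :
  p = (2 ^ e)%N -> (256 <= p)%N -> (N.+1 < p)%N ->
  X = take p (flatten (round_blocks p N i)) ->
  max_entry X / avg_entry X
    <= ln (2 : R) / (Num.sqrt 2 - 1) + 8 / p%:R.
Proof.
move=> pe p256 Np XE.
pose q : R := 2 `^ p%:R^-1.
have p0 : (0 < p)%N by rewrite (leq_trans _ p256).
have pR : 0 < p%:R :> R by rewrite ltr0n.
have [m [L [t [pmL hm tm HN]]]] := iter_merge_next_block R p e N q pe erefl Np.
have m0 : (0 < m)%N by lia.
have q1 : 1 < q by rewrite exp2_gt1 // invr_gt0.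
have q1' := ltW q1.
have rE : q ^+ L = 2 `^ m%:R^-1.
  have L0 : (0 < L)%N by case: L pmL p0 {HN} => // ->; rewrite muln0.
  rewrite /q exp2X; congr (_ `^ _); rewrite pmL natrM.
  by field; rewrite !pnatr_eq0 -!lt0n m0 L0.
set r := q ^+ L in HN rE.
have rm : r ^+ m = 2.
  by rewrite rE exp2X mulVf ?powRr1 // pnatr_eq0 -lt0n.
have r1 : 1 < r.
  have L0 : (0 < L)%N by case: L pmL p0 {HN rE r rm} => // ->; rewrite muln0.
  by rewrite /r exprn_egt1 // -lt0n.
pose blk B := [seq merged_block (q ^+ b / (q - 1)) r m (t + (b <= i)%N)
                | b <- iota 1 B].
have rbE : round_blocks p N i = blk p.
  by apply: eq_map => b; rewrite HN // leq_b1.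
rewrite {}rbE in XE.
have tm' : (t < m)%N by lia.
have sizes B := @size_flatten_blocks R (fun b => q ^+ b / (q - 1)) r m t i B tm'.
rewrite -/(blk _) in sizes.
have [||B [c [Bp cs tE Bc]]] := @take_flatten R p (blk p).
- by rewrite size_map size_iota.
- have := sizes p; rewrite -/(blk p); move: (size _) (geq_minl p i) => S Si.
  have : (2 <= m - t)%N by lia.
  move: (m - t)%N (minn p i) Si => n y yp; clear -yp; nia.
rewrite size_map size_iota in Bp.
have nthB : nth [::] (blk p) B
    = merged_block (q ^+ B.+1 / (q - 1)) r m (t + (B.+1 <= i)%N).
  by rewrite (nth_map 0%N) ?size_iota // nth_iota // add1n.
have takeB : take B (blk p) = blk B.
  by rewrite /blk -map_take take_iota (minn_idPl (ltnW Bp)).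
rewrite tE nthB takeB in XE; rewrite nthB size_mkseq in cs; rewrite takeB in Bc.
have sizeX : size X = p.
  by rewrite XE size_cat size_takel ?size_mkseq.
(* [i0] of the whole blocks are one merge ahead, each one entry short. *)
have := sizes B; set i0 := minn B i => sB.
pose n := (m - t)%N.
have eB : (B * n + c = p + i0)%N by rewrite -Bc -sB addnAC.
have nt : (n + t = m)%N by rewrite subnK // ltnW.
set t' := (t + (B < i))%N in XE cs.
have tt' : (t <= t')%N && (2 * t' <= m)%N by rewrite /t'; clear -tm; case: ltnP; lia.
have cn : (c <= n)%N by rewrite /n; clear -cs tt'; lia.
(* Merged entries come first and span two exponents each, so [c] entries span at least the fraction
   [c/n] of the exponents up to [m]. *)
have cf : (c * m <= breakpoint t' c * n)%N.
  have : (m - t' <= n)%N by rewrite /n; clear -tt'; lia.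
  case/andP: tt' => _; clear -cs; rewrite /breakpoint => tt' nn.
  have [d dE] : exists d, (t' + d = m)%N by exists (m - t')%N; clear -tt'; lia.
  have [ct|ct] := leqP c t'.
    by rewrite (minn_idPl _); [nia|lia].
  by rewrite (minn_idPr _); [nia|lia].
have main := main_inequality R q r p m L n t i0 B _ c p256 pmL hm nt tm cn
  (geq_minl _ _) eB cf erefl rE.
set W := (r ^+ 2 - 1) * r ^+ (2 * t) in main.
set D := (X in _ <= X) in main.
have W0 : 0 < W.
  have r0 : 0 < r by rewrite (lt_trans ltr01).
  by apply: mulr_gt0; [rewrite subr_gt0 exprn_egt1|exact: exprn_gt0].
have q10 : 0 < q - 1 by rewrite subr_gt0.
have q0 : 0 < q by rewrite (lt_trans ltr01).
have r0 : 0 < r by rewrite (lt_trans ltr01).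
have qb0 b : 0 <= q ^+ b / (q - 1) by rewrite divr_ge0 ?exprn_ge0 // ltW.
have entries x : x \in X -> x <= q * (q ^+ i0 * W) / (q - 1).
  move=> xX; have [b [bB xb]] : exists b, (b <= B.+1)%N /\
      x \in merged_block (q ^+ b / (q - 1)) r m (t + (b <= i)%N).
    move: xX; rewrite XE mem_cat => /orP[/flattenP[s /mapP[b]]|/mem_take xB].
      rewrite mem_iota add1n ltnS => /andP[_ bB] -> xb.
      by exists b; split => //; exact: leqW.
    by exists B.+1.
  have -> : q * (q ^+ i0 * W) / (q - 1) = q ^+ i0.+1 / (q - 1) * W.
    by rewrite exprS; ring.
  case: (leqP b i) xb => bi xb.
    rewrite addn1 in xb.
    apply: le_trans (block_succ_entry_le _ _ _ _ _ _ (qb0 b) r1 rm tm xb) _.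
    rewrite ler_pM2r // ler_pM2r ?invr_gt0 // ler_weXn2l //.
    by rewrite /i0; clear -bB bi; lia.
  rewrite addn0 in xb.
  have := block_entry_le _ _ _ _ _ _ (qb0 b) r1 rm tm xb; rewrite -/W => h.
  rewrite -(ler_pM2l (exprn_gt0 (t != 0%N).+1 r0)); apply: le_trans h _.
  rewrite [leRHS]mulrA ler_pM2r // [leRHS]mulrA ler_pM2r ?invr_gt0 // /r -exprM -exprD ler_weXn2l //.
  (* The prefix reaches at most [L] bases past [i + 1], or [2 L] if [t > 0], and [q^L = r]. *)
  have iB : (i <= B)%N by clear -bB bi; lia.
  have i0E : i0 = i by rewrite /i0; clear -iB; lia.
  rewrite i0E in eB *.
  have {}eB : ((B - i) * n <= m * L)%N.
    have n0 : (0 < n)%N by rewrite /n subn_gt0.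
    rewrite -pmL mulnBl leq_subLR addnC.
    by apply: (@leq_trans (p + i)); [clear -eB; lia|rewrite leq_add2l leq_pmulr].
  have nm : (m <= (t != 0).+1 * n)%N by clear -nt tm; case: eqVneq; lia.
  have : (B - i <= L * (t != 0).+1)%N.
    rewrite -(leq_pmul2r m0).
    by clear -nm eB; move: (t != 0).+1 nm => k nm; nia.
  by clear -bB iB; lia.
have sumX : \sum_(x <- X) x = q / (q - 1) ^+ 2 * D.
  rewrite XE big_cat /= sum_flatten_blocks // sum_take_block // /D (exprS q B).
  by move: (r ^+ _) (q ^+ B) => Z Y; field; exact: lt0r_neq0.
have [l1 l2] := ln2_bounds R; have [s1 s2] := sqrt2_bounds R.
have P0 : 0 < p%:R^-1 :> R by rewrite invr_gt0.
have P1 : p%:R^-1 <= 1 / 256 :> R.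
  by rewrite div1r lef_pV2 ?posrE ?ltr0n // ler_nat.
have V0 : 0 < q ^+ i0 * W by rewrite mulr_gt0 // exprn_gt0.
have zle := root2_sub1_le R p p0; rewrite -/q in zle.
set s := Num.sqrt 2 - 1 in main *.
have s0 : 0 < s by rewrite /s; clear -s1; lra.
have s0' : 29 / 70 >= s /\ s >= 70 / 169 by rewrite /s; clear -s1 s2; lra.
have P10 : 0 < 1 - p%:R^-1 :> R by clear -P1; lra.
have D0 : 0 < D by apply: lt_le_trans main; exact: mulr_gt0 (mulr_gt0 s0 P10) V0.
have M0 : 0 <= q * (q ^+ i0 * W) / (q - 1).
  exact: divr_ge0 (mulr_ge0 (ltW q0) (ltW V0)) (ltW q10).
have avgE : avg_entry X = q / (q - 1) ^+ 2 * D / p%:R.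
  by rewrite /avg_entry sumX sizeX.
have avg0 : 0 < avg_entry X by rewrite avgE !mulr_gt0 ?invr_gt0 ?exprn_gt0.
rewrite ler_pdivrMr //; apply: le_trans (max_entry_le _ _ _ M0 entries) _.
rewrite avgE.
set K := ln 2 / s; set V := q ^+ i0 * W in main V0 *.
have -> : q * V / (q - 1) = q / (q - 1) ^+ 2 / p%:R * ((q - 1) * p%:R * V).
  by field; rewrite !lt0r_neq0.
have -> : (K + 8 / p%:R) * (q / (q - 1) ^+ 2 * D / p%:R)
   = q / (q - 1) ^+ 2 / p%:R * ((K + 8 / p%:R) * D) by ring.
rewrite ler_pM2l ?mulr_gt0 ?invr_gt0 ?exprn_gt0 //.
rewrite -(ler_pM2l (mulr_gt0 s0 (exprn_gt0 2 P10))).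
have h1 : (q - 1) * p%:R * (1 - p%:R^-1) * (s * (1 - p%:R^-1) * V) <= ln 2 * D.
  exact: ler_pM (mulr_ge0 (mulr_ge0 (ltW q10) (ltW pR)) (ltW P10))
    (ltW (mulr_gt0 (mulr_gt0 s0 P10) V0)) zle main.
have K2 : K <= 2 by rewrite /K ler_pdivrMr //; clear -l2 s0'; lra.
(* The two factors [1 - 1/p] cost about [2 K/p <= 4/p], which [8/p] covers as [p >= 256]. *)
have h2 : K <= (1 - p%:R^-1) ^+ 2 * (K + 8 / p%:R).
  clear -K2 P0 P1; move: P0 P1; set P : R := p%:R^-1 => P0 P1.
  have a1 : 0 <= (2 - K) * (P * (2 - P)) by rewrite !mulr_ge0 //; lra.
  have a2 : 0 <= P * (1 - 16 * P) by rewrite mulr_ge0 //; lra.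
  have a3 : 0 <= P ^+ 3 by rewrite exprn_ge0 // ltW.
  by clear -a1 a2 a3 P0; lra.
have h3 := ler_wpM2l (ltW (mulr_gt0 s0 D0)) h2.
have sK : s * K = ln 2 by rewrite /K mulrC divfK // lt0r_neq0.
have h4 : ln 2 * D <= s * D * ((1 - p%:R^-1) ^+ 2 * (K + 8 / p%:R)).
  by apply: le_trans h3; rewrite -sK; clear; lra.
apply: le_trans (le_trans _ h4) _; last by clear; lra.
by apply: le_trans h1; clear; lra.
Qed.

Theorem theorem15 (R : realType) :
  (exists C : R, forall p : nat, (exists k : nat, p = (2 ^ k)%N) ->
     forall X : seq R, X \in periodic_scheme p (2 : R) ->
       max_entry X / avg_entry X
         <= ln (2 : R) / (Num.sqrt (2 : R) - 1) + C / p%:R)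
  /\ `| ln (2 : R) / (Num.sqrt (2 : R) - 1) - 1673%:R / 1000%:R |
       <= (2000%:R : R)^-1.
Proof.
split; last exact: limit_ratio_approx.
(* For [p >= 256] the constant 8 suffices; for [p < 256] the ratio is at most [p <= 256^2/p]. *)
exists (256 * 256) => p [k pk] X Xp.
have p0 : (0 < p)%N by rewrite pk expn_gt0.
have pR : 0 < p%:R :> R by rewrite ltr0n.
have [N [i [Np ip XE]]] := periodic_scheme_mem R p X p0 Xp.
have [p256|p256] := leqP 256 p.
  have Np' : (N.+1 < p)%N.
    by move: Np; rewrite (maxn_idPr _); lia.
  apply: le_trans (max_avg_round_blocks _ _ _ _ _ _ pk p256 Np' XE) _.
  by rewrite lerD2l ler_pM2r ?invr_gt0 //; lra.
have X0 x : x \in X -> 0 <= x.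
  rewrite XE => /mem_take/flattenP[s /mapP[b _ ->]].
  exact: iter_merge_next_ge0.
apply: le_trans (max_avg_le_size R X X0) _.
have K0 : 0 <= ln (2 : R) / (Num.sqrt 2 - 1).
  have [l1 _] := ln2_bounds R; have [s1 _] := sqrt2_bounds R.
  by rewrite divr_ge0 //; lra.
apply: (@le_trans _ _ p%:R).
  by rewrite ler_nat XE size_take_min geq_minl.
rewrite -[leLHS]add0r lerD // ler_pdivlMr // ler_pM ?ler0n // ler_nat ltnW //.
Qed.
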